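(* $\mathrm{GRA}(p,s,I)$ is equiexpressive with the set of relational $\mathrm{FO}$-atoms, and $\mathrm{GRA}(e,p,s,I)$ is equiexpressive with the set of $\mathrm{FO}$-atoms.
   Context: AD-relations. $A^0=\{\epsilon\}$, with $\epsilon$ the empty tuple. A $k$-ary AD-relation over a set $A$ is a pair $(R,k)$ with $R\subseteq A^k$, $k\ge 0$; $t\in(R,k)$ means $t\in R$. Vocabularies contain only relation symbols (of any arity $k\ge 0$). Models have nonempty domains; $A$ is the domain of $\mathfrak{A}$. Terms. $\mathrm{GRA}(e,p,s,I)$ is the set of terms built from relation symbols and the constant $e$ by the unary operators $p,s,I$; $\mathrm{GRA}(p,s,I)$ is the set of those terms not using $e$. Each term $\mathcal{T}$ defines in each model $\mathfrak{A}$ an AD-relation $\mathcal{T}^{\mathfrak{A}}$ of arity $k=\mathit{ar}(\mathcal{T})$. - $R^{\mathfrak{A}}$ is the interpretation of $R$, paired with the arity of $R$; $e^{\mathfrak{A}}=(\{(a,a)\mid a\in A\},2)$. - If $k\ge2$: $(p\mathcal{T})^{\mathfrak{A}}=(\{(a_k,a_1,\dots,a_{k-1})\mid(a_1,\dots,a_k)\in\mathcal{T}^{\mathfrak{A}}\},k)$; $(s\mathcal{T})^{\mathfrak{A}}=(\{(a_1,\dots,a_{k-2},a_k,a_{k-1})\mid(a_1,\dots,a_k)\in\mathcal{T}^{\mathfrak{A}}\},k)$; $(I\mathcal{T})^{\mathfrak{A}}=(\{(a_1,\dots,a_{k-1})\mid(a_1,\dots,a_k)\in\mathcal{T}^{\mathfrak{A}},\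 a_{k-1}=a_k\},k-1)$. If $k\le1$, each of $p\mathcal{T},s\mathcal{T},I\mathcal{T}$ is interpreted as $\mathcal{T}^{\mathfrak{A}}$. Formulas. Variables are $v_1,v_2,\dots$. $\mathrm{FO}$-atoms are the relational atoms $R(x_1,\dots,x_n)$ ($R$ an $n$-ary relation symbol, $x_1,\dots,x_n$ variables, repetitions allowed) and the equality atoms $x=y$ and $x=x$. A formula $\varphi$ whose free variables are exactly $v_{i_1},\dots,v_{i_k}$ with $i_1<\dots<i_k$ defines $\varphi^{\mathfrak{A}}=(\{(a_1,\dots,a_k)\in A^k\mid\mathfrak{A}\models\varphi(a_1,\dots,a_k)\},k)$, where $a_j$ is assigned to $v_{i_j}$. A formula $\varphi$ and a term $\mathcal{T}$ are equivalent if $\varphi^{\mathfrak{A}}=\mathcal{T}^{\mathfrak{A}}$ for every model $\mathfrak{A}$ whose vocabulary contains all symbols of $\varphi$ and $\mathcal{T}$. A set of terms and a set of formulas are equiexpressive if each term in the former has an equivalent formula in the latter and each formula in the latter has an equivalent term in the former. *)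

(* Defs.v *)
From mathcomp Require Import all_boot.
From mathcomp Require Import boolp classical_sets.

Set Implicit Arguments.
Unset Strict Implicit.
Unset Printing Implicit Defensive.

Local Open Scope classical_set_scope.

(** The arity is part of the data, so that the empty relations of different
    arities are different AD-relations. *)
Record adrel (A : Type) := ADRel { ad_arity : nat; ad_set : set (ad_arity.-tuple A) }.

Definition ad_eq (A : Type) : adrel A :=
  ADRel [set u : 2.-tuple A | exists a : A, u = [tuple a; a]].

(** In the next three definitions the tuple (a_1, ..., a_k), k >= 2, is
    decomposed from the right with [rcons]; arities 0 and 1 are left
    unchanged. *)
Definition ad_p (A : Type) (R : adrel A) : adrel A :=
  let: ADRel k X := R in
  match k return set (k.-tuple A) -> adrel A with
  | n.+2 => fun X => ADRel [set u : n.+2.-tuple A |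
      exists (w : n.+1.-tuple A) (a : A),
        X [tuple of rcons w a] /\ u = [tuple of a :: w]]
  | _ => fun X => ADRel X
  end X.

Definition ad_s (A : Type) (R : adrel A) : adrel A :=
  let: ADRel k X := R in
  match k return set (k.-tuple A) -> adrel A with
  | n.+2 => fun X => ADRel [set u : n.+2.-tuple A |
      exists (w : n.-tuple A) (a b : A),
        X [tuple of rcons (rcons w a) b] /\ u = [tuple of rcons (rcons w b) a]]
  | _ => fun X => ADRel X
  end X.

Definition ad_I (A : Type) (R : adrel A) : adrel A :=
  let: ADRel k X := R in
  match k return set (k.-tuple A) -> adrel A with
  | n.+2 => fun X => ADRel [set u : n.+1.-tuple A |
      exists (w : n.-tuple A) (a : A),
        X [tuple of rcons (rcons w a) a] /\ u = [tuple of rcons w a]]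
  | _ => fun X => ADRel X
  end X.

(** [Sym] with [ar] is the pool of relation symbols with their arities; the
    vocabulary of a model is a subset of it, and only the symbols of the
    vocabulary are interpreted. *)
Record model (Sym : Type) (ar : Sym -> nat) := Model {
  dom : Type;
  dom_inhabited : inhabited dom;
  voc : pred Sym;
  interp : forall R : Sym, voc R -> set ((ar R).-tuple dom) }.

Inductive term (Sym : Type) : Type :=
| TSym of Sym
| TEq
| TP of term Sym
| TS of term Sym
| TI of term Sym.
Arguments TEq {Sym}.

Fixpoint term_syms (Sym : Type) (T : term Sym) : seq Sym :=
  match T with
  | TSym R => [:: R]
  | TEq => [::]
  | TP T1 | TS T1 | TI T1 => term_syms T1
  end.

Fixpoint e_free (Sym : Type) (T : term Sym) : bool :=
  match T with
  | TSym _ => true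
  | TEq => false
  | TP T1 | TS T1 | TI T1 => e_free T1
  end.

Definition GRA_epsI (Sym : Type) : set (term Sym) := setT.
Definition GRA_psI (Sym : Type) : set (term Sym) := [set T | e_free T].

(** Symbols outside the vocabulary get a junk (empty) value; [equivalent]
    below never looks at it. *)
Definition sym_rel (Sym : Type) (ar : Sym -> nat) (M : model ar) (R : Sym) :
    set ((ar R).-tuple (dom M)) :=
  [set t | exists RM : voc M R, interp RM t].
Arguments sym_rel {Sym ar} M R _.

Fixpoint term_eval (Sym : Type) (ar : Sym -> nat) (M : model ar)
    (T : term Sym) : adrel (dom M) :=
  match T with
  | TSym R => ADRel (sym_rel M R)
  | TEq => ad_eq (dom M)
  | TP T1 => ad_p (term_eval M T1)
  | TS T1 => ad_s (term_eval M T1)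
  | TI T1 => ad_I (term_eval M T1)
  end.

(** The variable v_(i+1) is represented by the number [i]. *)
Inductive fo (Sym : Type) (ar : Sym -> nat) : Type :=
| FRel (R : Sym) of (ar R).-tuple nat
| FEq of nat & nat
| FNot of fo ar
| FAnd of fo ar & fo ar
| FEx of nat & fo ar.
Arguments FRel {Sym ar} R _.
Arguments FEq {Sym ar} _ _.

Fixpoint fo_syms (Sym : Type) (ar : Sym -> nat) (phi : fo ar) : seq Sym :=
  match phi with
  | FRel R _ => [:: R]
  | FEq _ _ => [::]
  | FNot psi | FEx _ psi => fo_syms psi
  | FAnd psi chi => fo_syms psi ++ fo_syms chi
  end.

Definition relational_atoms (Sym : Type) (ar : Sym -> nat) : set (fo ar) :=
  [set phi | exists (R : Sym) (xs : (ar R).-tuple nat), phi = FRel R xs].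

Definition equality_atoms (Sym : Type) (ar : Sym -> nat) : set (fo ar) :=
  [set phi | exists x y : nat, phi = FEq x y].

Definition fo_atoms (Sym : Type) (ar : Sym -> nat) : set (fo ar) :=
  @relational_atoms Sym ar `|` @equality_atoms Sym ar.

Fixpoint fo_sat (Sym : Type) (ar : Sym -> nat) (M : model ar)
    (g : nat -> dom M) (phi : fo ar) : Prop :=
  match phi with
  | FRel R xs => sym_rel M R [tuple of map g xs]
  | FEq x y => g x = g y
  | FNot psi => ~ fo_sat g psi
  | FAnd psi chi => fo_sat g psi /\ fo_sat g chi
  | FEx x psi => exists a : dom M, fo_sat (fun y => if y == x then a else g y) psi
  end.

(** Free variables, in no particular order and with repetitions. *)
Fixpoint fo_free (Sym : Type) (ar : Sym -> nat) (phi : fo ar) : seq nat :=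
  match phi with
  | FRel _ xs => xs
  | FEq x y => [:: x; y]
  | FNot psi => fo_free psi
  | FAnd psi chi => fo_free psi ++ fo_free chi
  | FEx x psi => [seq y <- fo_free psi | y != x]
  end.

Definition free_vars (Sym : Type) (ar : Sym -> nat) (phi : fo ar) : seq nat :=
  sort leq (undup (fo_free phi)).

(** The values of [g] outside the free variables are irrelevant. *)
Definition fo_eval (Sym : Type) (ar : Sym -> nat) (M : model ar)
    (phi : fo ar) : adrel (dom M) :=
  ADRel [set t : (size (free_vars phi)).-tuple (dom M) |
    exists g : nat -> dom M,
      (forall j, g (tnth (in_tuple (free_vars phi)) j) = tnth t j)
      /\ fo_sat g phi].

Definition equivalent (Sym : Type) (ar : Sym -> nat) (phi : fo ar)
    (T : term Sym) : Prop :=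
  forall M : model ar, all (voc M) (fo_syms phi) -> all (voc M) (term_syms T) ->
    fo_eval M phi = term_eval M T.

Definition equiexpressive (Sym : Type) (ar : Sym -> nat)
    (X : set (term Sym)) (Y : set (fo ar)) : Prop :=
  (forall T, X T -> exists2 phi, Y phi & equivalent phi T) /\
  (forall phi, Y phi -> exists2 T, X T & equivalent phi T).

(* Main.v *)
Require Import Defs.
From mathcomp Require Import all_boot.
From mathcomp Require Import boolp classical_sets.

(** Every term is built from a single base relation [X] (a symbol or [e]) by
    [p], [s] and [I], and it defines a relation of the form
    [pattern_rel X ys xs]: the values of the distinct variables [ys] for which
    the atom with argument list [xs] holds.  On such relations [p] rotates
    [ys], [s] swaps its last two entries, and [I] identifies its last two
    variables.  Conversely [p] and [s] generate all reorderings of [ys], and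
    any argument list arises from a repetition-free one by identifications. *)

(** * Reorderings generated by rotation and the last swap *)

Lemma perm_eq_rotr_swap_closed {T : eqType} (P : seq T -> Prop) :
  (forall s, P s -> P (rotr 1 s)) ->
  (forall w a b, P (rcons (rcons w a) b) -> P (rcons (rcons w b) a)) ->
  forall s t, perm_eq s t -> P s -> P t.
Proof.
move=> rotP swapP.
have catP u v : P (u ++ v) -> P (v ++ u).
  elim/last_ind: v u => [|v x IH] u; first by rewrite cats0.
  rewrite -rcons_cat => /rotP; rewrite rotr1_rcons -cat_cons => /IH.
  by rewrite cat_rcons.
(* Any adjacent transposition is a conjugate of the last swap: rotate the pair to the end, swap,
   rotate back. *)
have adjP u a b v : P (u ++ a :: b :: v) -> P (u ++ b :: a :: v).
  rewrite -(cat_rcons a) -(cat_rcons b) => /catP; rewrite -!rcons_cat.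
  move/swapP; rewrite !rcons_cat => /catP.
  by rewrite !cat_rcons.
have moveP x v u w : P (u ++ v ++ x :: w) -> P (u ++ x :: v ++ w).
  elim: v u => [|y v IH] u //=.
  by rewrite -cat_rcons => /IH; rewrite cat_rcons => /adjP.
suff gen t s u : perm_eq s t -> P (u ++ s) -> P (u ++ t).
  by move=> s t /(gen t s [::]).
elim: t s u => [|x t IH] s u; first by move/perm_nilP->.
move=> st; have xs : x \in s by rewrite (perm_mem st) mem_head.
case/splitPr: xs st => s1 s2 st.
(* Selection sort: [x], the next entry of the target, moves to the front of the remainder and joins
   the settled prefix [u]. *)
move/moveP; rewrite -!(cat_rcons x u) => /IH; apply.
by rewrite -(perm_cons x) -(permPr st) -cat1s perm_catCA.
Qed.

(** * AD-relations as predicates on sequences *)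

Definition ad_holds {A : Type} (R : adrel A) (s : seq A) : Prop :=
  exists2 t : (ad_arity R).-tuple A, ad_set t & tval t = s.

(** Membership of plain sequences avoids transports between tuple types whose lengths agree only
    propositionally. The arities are compared separately, since empty relations of different arities
    have the same members. *)
Lemma adrel_ext {A : Type} (R S : adrel A) : ad_arity R = ad_arity S ->
  (forall s, ad_holds R s <-> ad_holds S s) -> R = S.
Proof.
case: R S => [k X] [l Y] /= E; subst l => XY; congr ADRel.
apply/seteqP; split => t tX.
  have [|u Yu /val_inj <- //] := (XY t).1; by exists t.
have [|u Yu /val_inj <- //] := (XY t).2; by exists t.
Qed.

Lemma ad_p_arity {A : Type} (R : adrel A) : ad_arity (ad_p R) = ad_arity R.
Proof. by case: R => -[|[|k]]. Qed.

Lemma ad_s_arity {A : Type} (R : adrel A) : ad_arity (ad_s R) = ad_arity R.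
Proof. by case: R => -[|[|k]]. Qed.

Lemma ad_s_small {A : Type} (R : adrel A) : ad_arity R <= 1 -> ad_s R = R.
Proof. by case: R => -[|[|k]]. Qed.

Lemma ad_I_small {A : Type} (R : adrel A) : ad_arity R <= 1 -> ad_I R = R.
Proof. by case: R => -[|[|k]]. Qed.

Lemma ad_I_arity {A : Type} (R : adrel A) k :
  ad_arity R = k.+2 -> ad_arity (ad_I R) = k.+1.
Proof. by case: R => -[|[|n]] X //= [->]. Qed.

Lemma ad_holds_size {A : Type} (R : adrel A) s :
  ad_holds R s -> size s = ad_arity R.
Proof. by case=> t _ <-; rewrite size_tuple. Qed.

(** Small arities need no exception here: [rotr 1] fixes every sequence of length at most one, in
    accordance with the convention for [p]. *)
Lemma ad_p_holds {A : Type} (R : adrel A) s :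
  ad_holds (ad_p R) s <-> exists2 s', ad_holds R s' & s = rotr 1 s'.
Proof.
case: R => -[|[|k]] X.
- split=> [h|[s' h ->]].
    by exists s => //; have /size0nil-> := ad_holds_size _ _ h.
  by have /size0nil e := ad_holds_size _ _ h; rewrite e in h *.
- have r1 (s' : seq A) : size s' = 1 -> rotr 1 s' = s' by case: s' => [|a []].
  split=> [h|[s' h ->]].
    by exists s => //; rewrite r1 // (ad_holds_size _ _ h).
  by rewrite r1 // (ad_holds_size _ _ h).
- split=> [[t /= [w [a [Xwa ->]]] <-]|[s' [t Xt <-] ->]].
    exists (rcons w a); last by rewrite rotr1_rcons.
    by exists [tuple of rcons w a].
  case: t Xt; case/lastP => [//|w a] sz Xt.
  have szw : size w == k.+1 by have := sz; rewrite size_rcons eqSS.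
  exists [tuple of a :: Tuple szw]; last by rewrite /= rotr1_rcons.
  exists (Tuple szw), a; split=> //.
  by rewrite (_ : [tuple of _] = Tuple sz) //; apply: val_inj.
Qed.

Lemma ad_s_holds {A : Type} (R : adrel A) s : 1 < ad_arity R ->
  ad_holds (ad_s R) s <->
  exists w a b, ad_holds R (rcons (rcons w a) b) /\ s = rcons (rcons w b) a.
Proof.
case: R => -[|[|k]] X // _.
split=> [[t /= [w [a [b [Xw ->]]]] <-]|[w [a [b [[t Xt tw] ->]]]]].
  by exists w, a, b; split=> //; exists [tuple of rcons (rcons w a) b].
have szw : size w == k.
  by have /eqP := size_tuple t; rewrite tw !size_rcons !eqSS.
exists [tuple of rcons (rcons (Tuple szw) b) a] => //.
exists (Tuple szw), a, b; split=> //.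
by rewrite (_ : [tuple of _] = t) //; apply: val_inj.
Qed.

Lemma ad_I_holds {A : Type} (R : adrel A) s : 1 < ad_arity R ->
  ad_holds (ad_I R) s <->
  exists w a, ad_holds R (rcons (rcons w a) a) /\ s = rcons w a.
Proof.
case: R => -[|[|k]] X // _.
split=> [[t /= [w [a [Xw ->]]] <-]|[w [a [[t Xt tw] ->]]]].
  by exists w, a; split=> //; exists [tuple of rcons (rcons w a) a].
have szw : size w == k.
  by have /eqP := size_tuple t; rewrite tw !size_rcons !eqSS.
exists [tuple of rcons (Tuple szw) a] => //.
exists (Tuple szw), a; split=> //.
by rewrite (_ : [tuple of _] = t) //; apply: val_inj.
Qed.

(** * Pattern relations and the action of the operators on them *)

Definition pattern_rel {A : Type} (X : seq A -> Prop) (ys xs : seq nat) :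
    adrel A :=
  ADRel (fun t : (size ys).-tuple A =>
    exists g : nat -> A, map g ys = t /\ X (map g xs)).

Lemma pattern_rel_holds {A : Type} (X : seq A -> Prop) ys xs s :
  ad_holds (pattern_rel X ys xs) s <->
  exists g : nat -> A, map g ys = s /\ X (map g xs).
Proof.
split=> [[t [g [gt Xg]] <-]|[g [<- Xg]]]; first by exists g.
by exists [tuple of map g (in_tuple ys)] => //; exists g.
Qed.

Definition subst_var (z y x : nat) : nat := if x == z then y else x.

Lemma ad_p_pattern {A : Type} (X : seq A -> Prop) ys xs :
  ad_p (pattern_rel X ys xs) = pattern_rel X (rotr 1 ys) xs.
Proof.
apply: adrel_ext => [|s]; first by rewrite ad_p_arity /= size_rotr.
split.
  case/ad_p_holds => s' /pattern_rel_holds[g [<- Xg]] ->.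
  by apply/pattern_rel_holds; exists g; rewrite map_rotr.
case/pattern_rel_holds => g [<- Xg]; apply/ad_p_holds.
by exists (map g ys); rewrite ?map_rotr //; apply/pattern_rel_holds; exists g.
Qed.

Lemma ad_s_pattern {A : Type} (X : seq A -> Prop) ws y z xs :
  ad_s (pattern_rel X (rcons (rcons ws y) z) xs) =
  pattern_rel X (rcons (rcons ws z) y) xs.
Proof.
have ar2 : 1 < ad_arity (pattern_rel X (rcons (rcons ws y) z) xs).
  by rewrite /= !size_rcons.
apply: adrel_ext => [|s]; first by rewrite ad_s_arity /= !size_rcons.
split.
  case/(ad_s_holds _ _ ar2) => w [a [b [/pattern_rel_holds[g [gw Xg]] ->]]].
  apply/pattern_rel_holds; exists g; split=> //; move: gw.
  by rewrite !map_rcons => /rcons_inj[/rcons_inj[-> ->] ->].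
case/pattern_rel_holds => g [<- Xg]; apply/(ad_s_holds _ _ ar2).
exists (map g ws), (g y), (g z); rewrite !map_rcons; split=> //.
by apply/pattern_rel_holds; exists g; rewrite !map_rcons.
Qed.

Lemma ad_I_pattern {A : Type} (X : seq A -> Prop) ws y z xs :
  z \notin rcons ws y ->
  ad_I (pattern_rel X (rcons (rcons ws y) z) xs) =
  pattern_rel X (rcons ws y) (map (subst_var z y) xs).
Proof.
move=> zw; have ar2 : 1 < ad_arity (pattern_rel X (rcons (rcons ws y) z) xs).
  by rewrite /= !size_rcons.
apply: adrel_ext => [|s].
  by rewrite (@ad_I_arity _ _ (size ws)) /= !size_rcons.
split.
  case/(ad_I_holds _ _ ar2) => w [a [/pattern_rel_holds[g [gw Xg]] ->]].
  move: gw; rewrite !map_rcons => /rcons_inj[/rcons_inj[<- gy] gz].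
  apply/pattern_rel_holds; exists g; rewrite map_rcons gy; split=> //.
  rewrite -map_comp (_ : map _ xs = map g xs) //; apply: eq_map => x /=.
  by rewrite /subst_var; case: eqP => [->|//]; rewrite gy gz.
case/pattern_rel_holds => g [<- Xg]; apply/(ad_I_holds _ _ ar2).
exists (map g ws), (g y); rewrite map_rcons; split=> //.
(* This valuation gives [z] the value of [y]. As [z] is not in [rcons ws y], the other listed values
   do not change. *)
apply/pattern_rel_holds; exists (g \o subst_var z y).
rewrite map_comp; split=> //; last by rewrite map_comp.
rewrite -map_comp map_rcons /= {2}/subst_var eqxx; congr rcons.
rewrite -map_rcons; apply/eq_in_map => x xw /=.
by rewrite /subst_var; case: eqP => // xz; rewrite -xz xw in zw.
Qed.

(** Renaming each variable to its position makes the listing increasing, which is the order in which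
    a formula lists its free variables. *)
Lemma pattern_rel_index {A : Type} (X : seq A -> Prop) (ys xs : seq nat) :
  uniq ys -> {subset xs <= ys} ->
  pattern_rel X ys xs =
  pattern_rel X (iota 0 (size ys)) (map (index^~ ys) xs).
Proof.
move=> ys_uniq xsys.
apply: adrel_ext => [|s]; first by rewrite /= size_iota.
split=> /pattern_rel_holds[g [<- Xg]]; apply/pattern_rel_holds.
  exists (g \o nth 0 ys); split.
    by rewrite map_comp map_nth_iota0 // take_size.
  rewrite -map_comp (_ : map _ xs = map g xs) //.
  by apply/eq_in_map => x /xsys xy /=; rewrite nth_index.
exists (g \o index^~ ys); split; rewrite map_comp //.
congr map; apply: (@eq_from_nth _ 0) => [|i]; rewrite !size_map ?size_iota // => lti.
by rewrite nth_iota // (nth_map 0) // index_uniq.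
Qed.

Lemma pattern_rel_self {A : Type} (R : adrel A) ys : inhabited A -> uniq ys ->
  size ys = ad_arity R -> pattern_rel (ad_holds R) ys ys = R.
Proof.
case=> a0 ys_uniq szys; apply: adrel_ext => [//|s].
split=> [/pattern_rel_holds[g [<-]] //|Rs]; apply/pattern_rel_holds.
(* A variable outside [ys] has index [size ys], past the end of [s], and gets the default [a0]. *)
exists (fun x => nth a0 s (index x ys)).
suff -> : map (fun x => nth a0 s (index x ys)) ys = s by [].
have szs : size s = size ys by rewrite szys; apply: ad_holds_size.
apply: (@eq_from_nth _ a0) => [|i]; rewrite size_map // => lti.
by rewrite (nth_map 0) // index_uniq.
Qed.

(** * From terms to patterns *)

Fixpoint root {Sym : Type} (T : term Sym) : term Sym :=
  match T with
  | TP T1 | TS T1 | TI T1 => root T1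
  | _ => T
  end.

Lemma e_free_root {Sym : Type} (T : term Sym) : e_free (root T) = e_free T.
Proof. by elim: T. Qed.

Lemma root_base {Sym : Type} (T : term Sym) :
  (exists R, root T = TSym R) \/ root T = TEq.
Proof. by elim: T => //= [R|]; [left; exists R | right]. Qed.

Section Realization.
Context {Sym : Type} (ar : Sym -> nat).

Definition root_arity (T : term Sym) : nat :=
  if root T is TSym R then ar R else 2.

(** Induction on the term. The length of [xs] stays that of the base relation, because [I]
    identifies arguments without deleting them; [ys =i xs] makes [ys] an ordering of the free
    variables of an atom. *)
Lemma term_pattern (T : term Sym) : exists ys xs : seq nat,
  [/\ uniq ys, ys =i xs, size xs = root_arity T &
      forall M : model ar, term_eval M T =
        pattern_rel (ad_holds (term_eval M (root T))) ys xs].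
Proof.
have base (b : term Sym) : root b = b ->
    (forall M : model ar, ad_arity (term_eval M b) = root_arity b) ->
    exists ys xs : seq nat, [/\ uniq ys, ys =i xs, size xs = root_arity b &
      forall M : model ar, term_eval M b =
        pattern_rel (ad_holds (term_eval M (root b))) ys xs].
  move=> rb arb; exists (iota 0 (root_arity b)), (iota 0 (root_arity b)).
  split=> [||//|M]; rewrite ?iota_uniq ?size_iota // rb.
  rewrite pattern_rel_self ?iota_uniq ?size_iota //; exact: dom_inhabited.
elim: T => [R||T [ys [xs [uys ysxs szxs evT]]]|T [ys [xs [uys ysxs szxs evT]]]
  |T [ys [xs [uys ysxs szxs evT]]]].
- exact: base.
- exact: base.
- exists (rotr 1 ys), xs; split=> [|x||M] //; rewrite ?rotr_uniq ?mem_rotr //=.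
  by rewrite evT ad_p_pattern.
- case/lastP: ys => [|ys z] in uys ysxs evT *.
    by exists [::], xs; split=> // M; rewrite /= evT ad_s_small.
  case/lastP: ys => [|ys y] in uys ysxs evT *.
    by exists [:: z], xs; split=> // M; rewrite /= evT ad_s_small.
  have pe : perm_eq (rcons (rcons ys z) y) (rcons (rcons ys y) z).
    by rewrite -!cats1 -!catA perm_cat2l perm_catC.
  exists (rcons (rcons ys z) y), xs; split=> [|x||M] //.
  + by rewrite (perm_uniq pe).
  + by rewrite (perm_mem pe).
  + by rewrite /= evT ad_s_pattern.
- case/lastP: ys => [|ys z] in uys ysxs evT *.
    by exists [::], xs; split=> // M; rewrite /= evT ad_I_small.
  case/lastP: ys => [|ys y] in uys ysxs evT *.
    by exists [:: z], xs; split=> // M; rewrite /= evT ad_I_small.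
  (* Distinctness of the listed variables yields the freshness of [z] that [ad_I_pattern]
     requires. *)
  move: (uys); rewrite rcons_uniq => /andP[zys uys'].
  exists (rcons ys y), (map (subst_var z y) xs).
  split=> [//|x||M]; rewrite ?size_map //; last by rewrite /= evT ad_I_pattern.
  apply/idP/mapP => [xys|[x' x'xs ->]].
    exists x; first by rewrite -ysxs mem_rcons inE xys orbT.
    by rewrite /subst_var; case: eqP => // xz; rewrite -xz xys in zys.
  rewrite /subst_var; case: eqP => [_|/eqP xz].
    by rewrite mem_rcons mem_head.
  by move: x'xs; rewrite -ysxs mem_rcons inE (negPf xz).
Qed.

(** * From patterns to terms *)

Definition realized (b : term Sym) (ys xs : seq nat) : Prop :=
  exists2 T : term Sym, root T = b &
    forall M : model ar,
      term_eval M T = pattern_rel (ad_holds (term_eval M b)) ys xs.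

Lemma realized_perm b xs ys ys' :
  perm_eq ys ys' -> realized b ys xs -> realized b ys' xs.
Proof.
apply: (perm_eq_rotr_swap_closed (fun ys => realized b ys xs)).
  by move=> s [T <- ev]; exists (TP T) => // M; rewrite /= ev ad_p_pattern.
by move=> w y z [T <- ev]; exists (TS T) => // M; rewrite /= ev ad_s_pattern.
Qed.

Lemma fresh_var (s : seq nat) : exists z, z \notin s.
Proof.
exists (sumn s).+1; apply/negP.
have le_sumn : forall x, x \in s -> x <= sumn s.
  elim: s => //= y s IH x; rewrite inE => /orP[/eqP->|/IH]; first exact: leq_addr.
  by move/leq_trans; apply; apply: leq_addl.
by move/le_sumn; rewrite ltnn.
Qed.

(** Induction on [u] from the right: an argument that already occurs to its
    left is obtained by identifying a fresh variable with it. *)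
Lemma pattern_realized_split b (u v ys : seq nat) : root b = b ->
  (forall M : model ar, ad_arity (term_eval M b) = root_arity b) ->
  size (u ++ v) = root_arity b -> uniq v -> ~~ has (mem u) v ->
  uniq ys -> ys =i u ++ v -> realized b ys (u ++ v).
Proof.
move=> rb arb; elim/last_ind: u v ys => [|u x IH] v ys szuv uv disj uys ysuv.
  (* All arguments are now distinct, so [b] itself realizes the pattern up to a reordering. *)
  apply: (@realized_perm b _ v); first by apply: uniq_perm => // x; rewrite ysuv.
  exists b => // M; rewrite pattern_rel_self //; first exact: dom_inhabited.
  by rewrite arb.
move: disj szuv ysuv; rewrite has_sym cat_rcons has_rcons negb_or.
move=> /andP[xv disj] szuv ysuv.
(* A first occurrence just joins the repetition-free suffix [v]; a repeated one needs an
   identification. *)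
have [xu|xu] := boolP (x \in u); last first.
  apply: IH; rewrite //= ?xv // negb_or xu /= has_sym.
  exact: disj.
have [z zuv] := fresh_var (u ++ x :: v).
move: (zuv); rewrite mem_cat inE !negb_or => /and3P[zu zx zv].
have xys : x \in ys by rewrite ysuv mem_cat xu.
(* Listing [x] and then [z] last puts the two variables where [I] identifies them. *)
have [w yw] : exists w, perm_eq ys (rcons w x).
  by exists (rem x ys); rewrite perm_sym perm_rcons perm_sym perm_to_rem.
have zw : z \notin rcons w x by rewrite -(perm_mem yw) ysuv.
have [T rT evT] : realized b (rcons (rcons w x) z) (u ++ z :: v).
  apply: IH => /=.
  - by rewrite size_cat /= -szuv size_cat.
  - by rewrite zv.
  - by rewrite negb_or zu has_sym.
  - by rewrite rcons_uniq zw -(perm_uniq yw).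
  - move=> y; rewrite mem_rcons inE -(perm_mem yw) ysuv !mem_cat !inE.
    by case: (eqVneq y x) => [->|_]; rewrite ?xu ?orbT //= orbCA.
apply: (@realized_perm b _ (rcons w x)); first by rewrite perm_sym.
exists (TI T); first exact: rT.
move=> M; rewrite /= evT ad_I_pattern // map_cat /= {2}/subst_var eqxx.
(* Since [z] occurs in neither [u] nor [v], the substitution changes only the argument that it
   replaced. *)
have subst_id s : z \notin s -> map (subst_var z x) s = s.
  move=> zs; rewrite -[RHS]map_id; apply/eq_in_map => y ys'.
  by rewrite /subst_var; case: eqP => // yz; rewrite -yz ys' in zs.
by rewrite !subst_id.
Qed.

Lemma pattern_realized b (xs ys : seq nat) : root b = b ->
  (forall M : model ar, ad_arity (term_eval M b) = root_arity b) ->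
  size xs = root_arity b -> uniq ys -> ys =i xs -> realized b ys xs.
Proof.
move=> rb arb; rewrite -(cats0 xs) => szxs uys ysxs.
exact: pattern_realized_split.
Qed.

(** * Atoms as pattern relations *)

Lemma free_vars_uniq (phi : fo ar) : uniq (free_vars phi).
Proof. by rewrite sort_uniq undup_uniq. Qed.

Lemma mem_free_vars (phi : fo ar) : free_vars phi =i fo_free phi.
Proof. by move=> x; rewrite mem_sort mem_undup. Qed.

Lemma fo_eval_holds (M : model ar) (phi : fo ar) s :
  ad_holds (fo_eval M phi) s <->
  exists g : nat -> dom M, map g (free_vars phi) = s /\ fo_sat g phi.
Proof.
split=> [[t [g [gt sat]] <-]|[g [<- sat]]].
  suff -> : t = [tuple of map g (in_tuple (free_vars phi))] by exists g.
  by apply: eq_from_tnth => j; rewrite tnth_map gt.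
exists [tuple of map g (in_tuple (free_vars phi))] => //.
by exists g; split=> // j; rewrite tnth_map.
Qed.

Lemma fo_eval_rel (M : model ar) (R : Sym) (xs : (ar R).-tuple nat) :
  fo_eval M (FRel R xs) =
  pattern_rel (ad_holds (term_eval M (TSym R))) (free_vars (FRel R xs)) xs.
Proof.
apply: adrel_ext => [//|s]; split.
  case/fo_eval_holds => g [gs sat]; apply/pattern_rel_holds.
  by exists g; split=> //; exists [tuple of map g xs].
case/pattern_rel_holds => g [gs [t Xt tg]]; apply/fo_eval_holds.
exists g; split=> //=.
by rewrite (_ : [tuple of _] = t) //; apply: val_inj.
Qed.

Lemma fo_eval_eq (M : model ar) (x y : nat) :
  fo_eval M (FEq x y) =
  pattern_rel (ad_holds (term_eval M TEq)) (free_vars (FEq (ar := ar) x y))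
    [:: x; y].
Proof.
apply: adrel_ext => [//|s]; split.
  case/fo_eval_holds => g [gs /= gxy]; apply/pattern_rel_holds.
  exists g; split=> //; exists [tuple g x; g y] => //=.
  by exists (g x); rewrite gxy.
case/pattern_rel_holds => g [gs [t [a ->] [ax ay]]]; apply/fo_eval_holds.
by exists g; rewrite /= -ax -ay.
Qed.

(** Both sides are sorted and repetition-free with the same members: each position in [ys] is the
    index of some entry of [xs]. *)
Lemma sort_undup_index (ys xs : seq nat) : uniq ys -> ys =i xs ->
  sort leq (undup (map (index^~ ys) xs)) = iota 0 (size ys).
Proof.
move=> uys ysxs; apply: (sorted_eq leq_trans anti_leq).
- exact: sort_sorted leq_total _.
- exact: iota_sorted.
apply: uniq_perm; rewrite ?sort_uniq ?undup_uniq ?iota_uniq // => i.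
rewrite mem_sort mem_undup mem_iota add0n /=.
apply/mapP/idP => [[x xxs ->]|lti]; first by rewrite index_mem ysxs.
by exists (nth 0 ys i); rewrite ?index_uniq // -ysxs mem_nth.
Qed.

(** * Equivalence of terms and atoms *)

Lemma term_equivalent_atom (T : term Sym) :
  exists2 phi : fo ar,
    if root T is TSym _ then relational_atoms phi else equality_atoms phi &
    equivalent phi T.
Proof.
have [ys [xs [uys ysxs szxs evT]]] := term_pattern T.
have sub : {subset xs <= ys} by move=> x; rewrite ysxs.
have := sort_undup_index _ _ uys ysxs.
have : size (map (index^~ ys) xs) = root_arity T by rewrite size_map.
(* The operators may have left [ys] in any order; the renamed arguments form an atom whose sorted
   free variables match that order. *)
have {}evT M := etrans (evT M) (pattern_rel_index _ _ _ uys sub).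
move: (map _ xs) evT => zs evT szzs fvzs.
have [[R rT]|rT] := root_base T.
- move: szzs evT; rewrite /root_arity rT => /eqP szzs evT.
  exists (FRel R (Tuple szzs)); first by exists R, (Tuple szzs).
  by move=> M _ _; rewrite fo_eval_rel evT /free_vars /= fvzs.
- move: szzs evT; rewrite /root_arity rT.
  case: zs fvzs => [|x [|y []]] // fvzs _ evT.
  exists (FEq x y); first by exists x, y.
  by move=> M _ _; rewrite fo_eval_eq evT -fvzs.
Qed.

Lemma relational_atom_equivalent_term (phi : fo ar) : relational_atoms phi ->
  exists2 T : term Sym, e_free T & equivalent phi T.
Proof.
case=> R [xs ->].
have [//|//||||T rT evT] :=
  @pattern_realized (TSym R) xs (free_vars (FRel R xs)).
- by rewrite size_tuple.
- exact: free_vars_uniq.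
- exact: mem_free_vars.
(* Only the root can contain [e], and here it is the symbol [R]. *)
exists T; first by rewrite -e_free_root rT.
by move=> M _ _; rewrite fo_eval_rel evT.
Qed.

(** The atom [x = x] is included: its single free variable results from an identification applied to
    [e]. *)
Lemma equality_atom_equivalent_term (phi : fo ar) : equality_atoms phi ->
  exists T : term Sym, equivalent phi T.
Proof.
case=> x [y ->].
have [//|//|//|||T _ evT] :=
  @pattern_realized TEq [:: x; y] (free_vars (FEq (ar := ar) x y)).
- exact: free_vars_uniq.
- exact: mem_free_vars.
by exists T => M _ _; rewrite fo_eval_eq evT.
Qed.

End Realization.

Theorem corollary3p2 (Sym : Type) (ar : Sym -> nat) :
  equiexpressive (@GRA_psI Sym) (@relational_atoms Sym ar) /\
  equiexpressive (@GRA_epsI Sym) (@fo_atoms Sym ar).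
Proof.
split; split.
- move=> T; rewrite /GRA_psI /= -e_free_root.
  have [phi] := term_equivalent_atom ar T.
  by have [[R ->]|->] := root_base T => //= phiR ev _; exists phi.
- exact: relational_atom_equivalent_term.
- move=> T _; have [phi phiT ev] := term_equivalent_atom ar T.
  by exists phi => //; case: (root T) phiT => *; [left | right..].
- move=> phi [/relational_atom_equivalent_term[T _ ev]
             |/equality_atom_equivalent_term[T ev]]; by exists T.
Qed.
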